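(* There exists a Leja sequence $(H_n)_{n\ge1}\subset\mathbb{C}^2$ for the closed unit bidisc $\overline{\mathbb{D}}^2$ that cannot be written as the intertwining sequence of two complex sequences. In addition, writing $H_n=(u_n,v_n)$, none of its components $(u_n)_{n\ge1}$, $(v_n)_{n\ge1}$ is a (one-dimensional) Leja sequence for $\overline{\mathbb{D}}$.
   Context: $\overline{\mathbb{D}}=\{z\in\mathbb{C}:|z|\le1\}$. Numeration: $n\mapsto(k(n),l(n))$, $n\ge1$, enumerates $\mathbb{N}^2$ ($\mathbb{N}=\{0,1,\ldots\}$) by increasing $k+l$, and for equal $k+l$ by increasing $k$: $(0,0),(0,1),(1,0),(0,2),(1,1),(2,0),\ldots$ The intertwining sequence of complex sequences $(\eta_i)_{i\ge0},(\theta_j)_{j\ge0}$ is $n\mapsto(\eta_{k(n)},\theta_{l(n)})\in\mathbb{C}^2$, $n\ge1$. Let $e_n(z,w)=z^{k(n)}w^{l(n)}$; for $X_1,\ldots,X_N\in\mathbb{C}^2$, $\mathrm{VDM}(X_1,\ldots,X_N)=\det[e_i(X_j)]_{1\le i,j\le N}$. Bidimensional Leja sequence: a Leja sequence for a compact set $K\subset\mathbb{C}^2$ is a sequence $(H_n)_{n\ge1}$ of elements of $K$ with $H_1\in\partial K$ and, for all $N\ge1$, $|\mathrm{VDM}(H_1,\ldots,H_N,H_{N+1})|=\sup_{(z,w)\in K}|\mathrm{VDM}(H_1,\ldots,H_N,(z,w))|$. One-dimensional Leja sequence: a Leja sequence for a compact set $K\subset\mathbb{C}$ is a sequence $(\eta_i)_{i\ge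 0}$ of elements of $K$ with $\eta_0\in\partial K$ and, for all $k\ge 1$, $\sup_{z\in K}\prod_{i=0}^{k-1}|z-\eta_i|=\prod_{i=0}^{k-1}|\eta_k-\eta_i|$ (for a component $(u_n)_{n\ge1}$, take $\eta_i=u_{i+1}$). *)

(* Defs.v *)
From mathcomp Require Import all_boot all_order all_algebra.
From mathcomp Require Import complex.
From mathcomp Require Import all_classical all_reals all_analysis.
From mathcomp Require Import zify.
Set Implicit Arguments.
Unset Strict Implicit.
Unset Printing Implicit Defensive.
Import Order.TTheory GRing.Theory Num.Theory numFieldNormedType.Exports.
Local Open Scope classical_set_scope.
Local Open Scope ring_scope.

(* Sequences written with indices n >= 1 in the mathematics are
   indexed from 0 here: [H n] stands for H_{n+1}. *)

(* [R[i]] packed as a numClosedFieldType, so that it inherits the topology that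
   MathComp-Analysis puts on numeric fields, and [C R * C R] the product
   topology. *)
Definition C (R : realType) : numClosedFieldType := R[i].

(* The complex modulus with values in [R] rather than in [R[i]]. *)
Definition modulus (R : realType) (z : C R) : R := ComplexField.Normc.normc z.

Definition boundary (T : topologicalType) (K : set T) : set T :=
  closure K `\` interior K.

Definition closed_disc (R : realType) : set (C R) := [set z | `|z| <= 1].

Definition closed_bidisc (R : realType) : set (C R * C R) :=
  @closed_disc R `*` @closed_disc R.

(* The successor of (k, l) in the enumeration of N^2 by increasing k + l, then
   increasing k. *)
Definition next_kl (p : nat * nat) : nat * nat :=
  if p.2 is l.+1 then (p.1.+1, l) else (0%N, p.1.+1).

(* [numeration n] is (k(n+1), l(n+1)). *)
Definition numeration (n : nat) : nat * nat := iter n next_kl (0%N, 0%N).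

(* The next two lemmas characterise [numeration]. *)
Lemma numeration_lt (m n : nat) : (m < n)%N ->
  let: (k, l) := numeration m in let: (k', l') := numeration n in
  (k + l < k' + l')%N || (k + l == k' + l')%N && (k < k')%N.
Proof.
elim: n => [//|n IHn]; rewrite ltnS leq_eqVlt /numeration iterS -!/(numeration _).
case/predU1P => [->|/IHn].
  by case: (numeration n) => k [|l]; rewrite /next_kl /=; lia.
case: (numeration m) => a b; case: (numeration n) => k [|l].
all: by rewrite /next_kl /=; lia.
Qed.

Lemma numeration_surj (p : nat * nat) : exists n, numeration n = p.
Proof.
suff diag s : forall k, (k <= s)%N -> exists n, numeration n = (k, s - k)%N.
  case: p => k l; have [n nE] := diag (k + l)%N k (leq_addr _ _).
  by exists n; rewrite nE addKn.
elim: s => [|s IHs]; first by case=> // _; exists 0%N.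
elim=> [_|k IHk ks].
  have [n nE] := IHs s (leqnn s).
  by exists n.+1; rewrite /numeration iterS -/(numeration n) nE subnn.
have [n nE] := IHk (ltnW ks).
by exists n.+1; rewrite /numeration iterS -/(numeration n) nE subSn.
Qed.

Definition intertwining (R : realType) (eta theta : nat -> C R) (n : nat) :
    C R * C R :=
  (eta (numeration n).1, theta (numeration n).2).

Definition monomial (R : realType) (n : nat) (p : C R * C R) : C R :=
  p.1 ^+ (numeration n).1 * p.2 ^+ (numeration n).2.

Definition VDM (R : realType) (N : nat) (X : 'I_N -> C R * C R) : C R :=
  \det (\matrix_(i < N, j < N) monomial i (X j)).

(* [append H N p] is the (N + 1)-tuple (H_1, ..., H_N, p). *)
Definition append (T : Type) (H : nat -> T) (N : nat) (p : T) (j : 'I_N.+1) :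
    T :=
  if (j < N)%N then H j else p.

(* Both notions of Leja sequence are meant for compact [K], where the suprema
   are taken over bounded nonempty sets of reals. *)
Definition is_leja2 (R : realType) (K : set (C R * C R))
    (H : nat -> C R * C R) : Prop :=
  [/\ forall n, K (H n),
      boundary K (H 0%N) &
      forall N, (1 <= N)%N ->
        modulus (VDM (@append _ H N (H N))) =
        sup [set modulus (VDM (@append _ H N p)) | p in K]].

Definition is_leja1 (R : realType) (K : set (C R)) (eta : nat -> C R) : Prop :=
  [/\ forall i, K (eta i),
      boundary K (eta 0%N) &
      forall k, (1 <= k)%N ->
        sup [set \prod_(i < k) modulus (z - eta i) | z in K] =
        \prod_(i < k) modulus (eta k - eta i)].

(* Main.v *)
(* |VDM(H_1, (z, w))| = |w - v_1| does not depend on z, so after H_1 = (1, 1)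
   one may take H_2 = (0, -1).  Then |VDM(H_1, H_2, (z, w))| = |-2 z + w + 1| is
   maximal, equal to 4, at H_3 = (-1, 1), and the sequence is continued greedily
   by compactness of the bidisc.  An intertwining sequence has u_1 = u_2, which
   fails; (u_n) is not Leja because |u_2 - u_1| = 1 < 2; (v_n) is not Leja
   because v_3 = v_1. *)
Require Import Defs.
From mathcomp Require Import all_boot all_order all_algebra.
From mathcomp Require Import complex.
From mathcomp Require Import all_classical all_reals all_analysis.
From mathcomp Require Import ring.
Set Implicit Arguments.
Unset Strict Implicit.
Unset Printing Implicit Defensive.
Import Order.TTheory GRing.Theory Num.Theory numFieldNormedType.Exports.
Local Open Scope classical_set_scope.
Local Open Scope ring_scope.

Lemma sup_image_max (R : realType) (T : Type) (f : T -> R) (K : set T) (p : T) :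
  K p -> (forall q, K q -> f q <= f p) -> f p = sup [set f q | q in K].
Proof.
move=> Kp fp; apply/eqP; rewrite eq_le; apply/andP; split.
  by apply: ub_le_sup; [exists (f p) => _ [q Kq <-]; exact: fp | exists p].
by apply: ge_sup; [exists (f p), p | move=> _ [q Kq <-]; exact: fp].
Qed.

(** The norm of [C R] takes its values in [C R], while suprema need reals; this conversion lets norm
    lemmas serve for [modulus]. *)
Lemma norm_modulus (R : realType) (z : C R) : `|z| = (modulus z)%:C%C.
Proof. by []. Qed.

Lemma modulus_ge0 (R : realType) (z : C R) : 0 <= modulus z.
Proof. by case: z => x y; rewrite sqrtr_ge0. Qed.

Lemma ler_modulus (R : realType) (z w : C R) :
  (modulus z <= modulus w) = (`|z| <= `|w|).
Proof. by rewrite !norm_modulus lecR. Qed.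

Lemma modulusN (R : realType) (z : C R) : modulus (- z) = modulus z.
Proof. by apply/le_anti; rewrite !ler_modulus normrN lexx. Qed.

Lemma modulusM (R : realType) (z w : C R) :
  modulus (z * w) = modulus z * modulus w.
Proof. exact: ComplexField.Normc.normcM. Qed.

Lemma closed_discE (R : realType) :
  @closed_disc R = [set z | modulus z <= 1].
Proof.
by apply/seteqP; split=> z; rewrite /closed_disc /= norm_modulus -lecR.
Qed.

Lemma continuous_modulus (R : realType) : continuous (@modulus R).
Proof.
move=> z; apply/(@cvgrPdist_lt _ _ _ _ (nbhs_filter z)) => e e0.
(* The modulus is 1-Lipschitz, so the radius is [e] itself, embedded in [C R]. *)
exists (e%:C%C : C R) => [|w /=]; first by rewrite /= ltcR.
rewrite norm_modulus ltcR; apply: le_lt_trans.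
have D (x y : C R) : modulus (x + y) <= modulus x + modulus y.
  exact: le_normcD.
rewrite ler_norml lerNl opprB !lerBlDr; apply/andP; split.
  by have := D (w - z) z; rewrite subrK -[w - z]opprB modulusN.
by have := D (z - w) w; rewrite subrK.
Qed.

Lemma continuous_Complex (R : realType) :
  continuous (fun p : R * R => (p.1 +i* p.2)%C : C R).
Proof.
move=> p; apply/(@cvgrPdist_lt _ _ _ _ (nbhs_filter p)) => e e0.
(* A positive element of [C R] is real, so [e] may be replaced by its real part. *)
have {}e0 : 0 < complex.Re e /\ e = (complex.Re e)%:C%C.
  by move: e0; case: e => a b; rewrite ltcE /= => /andP[/eqP -> ->].
case: e0 => e0 ->.
have e20 : 0 < complex.Re e / 2 by rewrite divr_gt0.
near=> q.
rewrite norm_modulus ltcR.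
have h1 : `|p.1 - q.1| < complex.Re e / 2.
  by near: q; apply: (@cvgr_dist_lt _ _ _ _ _ fst); [exact: cvg_fst|].
have h2 : `|p.2 - q.2| < complex.Re e / 2.
  by near: q; apply: (@cvgr_dist_lt _ _ _ _ _ snd); [exact: cvg_snd|].
have le : modulus ((p.1 +i* p.2)%C - (q.1 +i* q.2)%C : C R) <=
    `|p.1 - q.1| + `|p.2 - q.2|.
  (* Compare squares: the right-hand side exceeds by twice the product of the absolute values. *)
  rewrite /modulus /=; rewrite -[leRHS]ger0_norm ?addr_ge0// -sqrtr_sqr.
  rewrite ler_wsqrtr // [leRHS]sqrrD !real_normK ?num_real //.
  by rewrite addrAC lerDl mulrn_wge0 // mulr_ge0.
by rewrite (le_lt_trans le)// [ltRHS]splitr ltrD.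
Unshelve. all: by end_near. Qed.

(** Compactness comes from $\mathbb{R}^2$: the disc is a closed subset of the continuous image of
    the square $[-1,1]^2$. *)
Lemma compact_closed_disc (R : realType) : compact (@closed_disc R).
Proof.
have sq : compact ((fun p : R * R => (p.1 +i* p.2)%C : C R) @`
    (`[-1, 1]%classic `*` `[-1, 1]%classic)).
  apply: continuous_compact; last by apply: compact_setX; exact: segment_compact.
  by apply: continuous_subspaceT; exact: continuous_Complex.
apply: subclosed_compact sq _.
  rewrite closed_discE; apply: (@preimage_closed _ _ (@modulus R) [set x | x <= 1]).
    by move=> ? _; exact: continuous_modulus.
  exact: closed_le.
rewrite closed_discE => -[x y] /= h; exists (x, y) => //=.
have b (a c : R) : Num.sqrt (a ^+ 2 + c ^+ 2) <= 1 -> -1 <= a <= 1.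
  rewrite -ler_norml; apply: le_trans.
  by rewrite -sqrtr_sqr ler_wsqrtr // lerDl sqr_ge0.
by split; rewrite in_itv /=; [exact: b h | apply: (b y x); rewrite addrC].
Qed.

Lemma continuousX (K : numFieldType) (T : topologicalType) (f : T -> K)
  (k : nat) : continuous f -> continuous (fun x => f x ^+ k).
Proof.
move=> cf x; elim: k => [|k IHk]; first exact: cvg_cst.
rewrite (_ : (fun x => _) = fun x => f x * f x ^+ k).
  by apply: cvgM => //; exact: cf.
by apply/funext => y; rewrite exprS.
Qed.

Lemma continuous_monomial (R : realType) (n : nat) :
  continuous (@monomial R n).
Proof.
move=> p; apply: cvgM.
  by apply: (@continuousX _ _ fst) => q; exact: cvg_fst.
by apply: (@continuousX _ _ snd) => q; exact: cvg_snd.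
Qed.

(** Expand along the last column, the only one containing [p]: the cofactors are constants, and
    continuity in [p] follows. *)
Lemma VDM_appendE (R : realType) (H : nat -> C R * C R) (N : nat) :
  exists c : 'I_N.+1 -> C R,
    forall p, VDM (@append _ H N p) = \sum_(i < N.+1) monomial i p * c i.
Proof.
(* The point [(0, 0)] is a placeholder: it fills the column that the cofactors delete. *)
exists (fun i =>
  cofactor (\matrix_(i, j) monomial i (append H (0, 0) j)) i ord_max) => p.
rewrite /VDM (expand_det_col _ ord_max); apply: eq_bigr => i _.
rewrite mxE {1}/append ltnn; congr (_ * (_ * \det _)).
by apply/matrixP => a b; rewrite !mxE /append !lift_max !ltn_ord.
Qed.

Lemma continuous_VDM_append (R : realType) (H : nat -> C R * C R) (N : nat) :
  continuous (fun p => modulus (VDM (@append _ H N p))).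
Proof.
have [c cE] := VDM_appendE H N.
move=> p; apply: (@continuous_comp _ _ _ (fun p => VDM (append H p))); last first.
  exact: continuous_modulus.
rewrite (_ : (fun p => _) = fun p => \sum_(i < N.+1) monomial i p * c i);
  last exact/funext.
apply: (@cvg_big _ _ +%R) => [|i _].
  exact: add_continuous.
by apply: cvgMl; exact: continuous_monomial.
Qed.

Lemma VDM_append_max (R : realType) (H : nat -> C R * C R) (N : nat) :
  exists p, closed_bidisc p /\ forall q, closed_bidisc q ->
    modulus (VDM (@append _ H N q)) <= modulus (VDM (@append _ H N p)).
Proof.
have [||| p pK pmax] := @compact_EVT_max _ _
    (fun p => modulus (VDM (@append _ H N p))) (@closed_bidisc R).
- by exists (0, 0); split; rewrite /closed_disc /= normr0 ler01.
- by apply: compact_setX; exact: compact_closed_disc.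
- by apply: continuous_subspaceT; exact: continuous_VDM_append.
by exists p; split=> [|q qK]; [exact/set_mem | apply/pmax/mem_set].
Qed.

Lemma VDM_append1 (R : realType) (H : nat -> C R * C R) (p : C R * C R) :
  VDM (@append _ H 1 p) = p.2 - (H 0%N).2.
Proof.
rewrite /VDM (expand_det_col _ ord0) !big_ord_recl big_ord0 /cofactor.
rewrite !det_mx11 !mxE /append /monomial /=; ring.
Qed.

(** The first three monomials are $1, w, z$; subtracting the first column leaves a 2 by 2
    determinant of differences. *)
Lemma VDM_append2 (R : realType) (H : nat -> C R * C R) (p : C R * C R) :
  VDM (@append _ H 2 p) =
  ((H 1%N).2 - (H 0%N).2) * (p.1 - (H 0%N).1) -
  ((H 1%N).1 - (H 0%N).1) * (p.2 - (H 0%N).2).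
Proof.
rewrite /VDM (expand_det_col _ ord0) !big_ord_recl big_ord0 /cofactor.
do ! rewrite (expand_det_col _ ord0) !big_ord_recl big_ord0 /cofactor.
rewrite !det_mx00 !mxE /append /monomial /=; ring.
Qed.


Lemma boundary_bidisc (R : realType) (w : C R) :
  closed_disc w -> boundary (@closed_bidisc R) (1, w).
Proof.
move=> wD; split.
  by apply: subset_closure; split=> //=; rewrite /closed_disc /= normr1.
move=> [[A B] [/= [e /= e0 Ae] [d /= d0 Bd]] AB].
have e2 : 0 < e / 2 by rewrite divr_gt0.
(* Pushing the first coordinate outwards by [e / 2] stays in the neighbourhood but leaves the
   bidisc. *)
have /AB [/= + _] : (A `*` B) (1 + e / 2, w).
  split=> /=; [apply: Ae | apply: Bd].
    rewrite /= opprD addrA subrr add0r normrN gtr0_norm //.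
    by rewrite [ltRHS]splitr ltrDl.
  by rewrite /= subrr normr0.
rewrite /closed_disc /= ger0_norm; last by rewrite addr_ge0 // ltW.
by rewrite lt_geF // ltrDl.
Qed.

Lemma leja1_max (R : realType) (eta : nat -> C R) (k : nat) (z : C R) :
  is_leja1 (@closed_disc R) eta -> (1 <= k)%N -> closed_disc z ->
  \prod_(i < k) modulus (z - eta i) <= \prod_(i < k) modulus (eta k - eta i).
Proof.
move=> [etaD _ etaP] k1 zD; rewrite -etaP //; apply: ub_le_sup; last by exists z.
(* The supremum bounds its set only once that set is bounded above; distances in the disc are at
   most 2. *)
exists (\prod_(i < k) 2) => _ [x xD <-]; apply: ler_prod => i _.
rewrite modulus_ge0 -lecR -norm_modulus (le_trans (ler_normB _ _)) //.
by rewrite rmorphD rmorph1 lerD //; exact: etaD.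
Qed.

(** Each point depends on all earlier ones, so the recursion runs on finite lists: [hist m] holds
    the first [m] points, and [g], obtained by choice, returns a maximiser for a given list. *)
Lemma bidisc_greedy_extension (R : realType) (n : nat)
  (H0 : nat -> C R * C R) :
  exists H : nat -> C R * C R,
    (forall i, (i < n)%N -> H i = H0 i) /\
    forall N, (n <= N)%N -> closed_bidisc (H N) /\
      forall q, closed_bidisc q ->
        modulus (VDM (@append _ H N q)) <= modulus (VDM (@append _ H N (H N))).
Proof.
have [g gP] := choice (fun s : seq (C R * C R) =>
  VDM_append_max (nth (0, 0) s) (size s)).
pose F s := if (size s < n)%N then H0 (size s) else g s.
pose hist := fix hist m := if m is m'.+1 then rcons (hist m') (F (hist m'))
  else [::].
pose H m := F (hist m).
have sz m : size (hist m) = m by elim: m => //= m IHm; rewrite size_rcons IHm.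
have hE m i : (i < m)%N -> nth (0, 0) (hist m) i = H i.
  elim: m => // m IHm; rewrite ltnS leq_eqVlt /= nth_rcons sz => /predU1P[->|im].
    by rewrite ltnn eqxx.
  by rewrite im IHm.
exists H; split=> [i ltin|N leNn]; first by rewrite /H /F sz ltin.
have HN : H N = g (hist N) by rewrite /H /F sz ltnNge leNn.
have := gP (hist N); rewrite sz -HN => -[HK Hmax]; split=> // q /Hmax.
(* [append] reads only indices below [N], where the list agrees with [H]. *)
have aE p : @append _ (nth (0, 0) (hist N)) N p = @append _ H N p.
  by apply/funext => j; rewrite /append; case: ifP => // /hE.
by rewrite !aE.
Qed.

Theorem proposition3 (R : realType) :
  exists H : nat -> C R * C R,
    [/\ is_leja2 (@closed_bidisc R) H,
        ~ (exists eta theta : nat -> C R,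
             forall n : nat, H n = intertwining eta theta n),
        ~ is_leja1 (@closed_disc R) (fun n : nat => (H n).1) &
        ~ is_leja1 (@closed_disc R) (fun n : nat => (H n).2)].
Proof.
have [H [H0 Hmax]] := bidisc_greedy_extension 3
  (nth (0, 0) [:: (1, 1); (0, -1); (-1, 1)] : nat -> C R * C R).
have H0E := H0 0%N isT; have H1E := H0 1%N isT; have H2E := H0 2%N isT.
rewrite /= in H0E H1E H2E.
have D0 : closed_disc (0 : C R) by rewrite /closed_disc /= normr0.
have D1 : closed_disc (1 : C R) by rewrite /closed_disc /= normr1.
have DN1 : closed_disc (-1 : C R) by rewrite /closed_disc /= normrN1.
exists H; split.
- have HK n : closed_bidisc (H n).
    case: n => [|[|[|n]]]; rewrite ?H0E ?H1E ?H2E; try by split.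
    by have [] := Hmax n.+3 isT.
  split=> // [|N N1]; first by rewrite H0E; exact: boundary_bidisc.
  apply: (sup_image_max (f := fun p => modulus (VDM (@append _ H N p)))) => // q.
  (* Maximality is automatic from index 3 on; the prescribed points at indices 1 and 2 are checked
     by the triangle inequality. *)
  case: N N1 => [//|[|[|N]]] _; last by apply: (Hmax N.+3 _).2.
    move=> [_ q2]; rewrite !VDM_append1 ler_modulus H0E H1E /=.
    rewrite -opprD normrN (@ger0_norm _ (1 + 1)) ?addr_ge0 ?ler01 //.
    by rewrite (le_trans (ler_normB _ _)) // normr1 lerD.
  move=> [q1 q2]; rewrite !VDM_append2 ler_modulus H0E H1E H2E /=.
  rewrite (_ : _ - _ = - 2 * q.1 + q.2 + 1); last by ring.
  rewrite (_ : (-1 - 1) * (-1 - 1) - _ = 4); last by ring.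
  rewrite normr_nat (le_trans (ler_normD _ _)) // normr1.
  rewrite (le_trans (lerD (ler_normD _ _) (lexx _))) // normrM normrN normr_nat.
  rewrite (_ : 4 = 2 * 1 + 1 + 1 :> C R); last by ring.
  by rewrite !lerD // ler_wpM2l.
(* Indices 0 and 1 have numeration $(0,0)$ and $(0,1)$, so [eta 0] would be both 1 and 0. *)
- move=> [eta [theta HE]]; have := HE 0%N; have := HE 1%N.
  rewrite H0E H1E /intertwining /= => -[<- _] [/eqP + _].
  by rewrite oner_eq0.
(* The point $-1$ is at distance 2 from $u_1=1$, but $u_2=0$ only at distance 1. *)
- move=> /leja1_max -/(_ 1%N (-1) isT DN1).
  rewrite !big_ord_recl !big_ord0 !mulr1 H0E H1E ler_modulus /=.
  rewrite sub0r -opprD !normrN normr1 ger0_norm ?addr_ge0 ?ler01 //.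
  by rewrite gerDl ler10.
(* At the test point 0 the product of distances to $1$ and $-1$ is 1; at $v_3=1$ it vanishes. *)
- move=> /leja1_max -/(_ 2%N 0 isT D0).
  rewrite !big_ord_recl !big_ord0 !mulr1 H0E H1E H2E -!modulusM ler_modulus /=.
  rewrite subrr mul0r normr0 sub0r opprK add0r.
  by rewrite mulr1 normrN1 ler10.
Qed.
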